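(* Let $X_1,X_2,Y$ be real Banach spaces, let $X=X_1\oplus_\infty X_2$, let $T: X\to Y$ be a bounded linear operator, and let $T_1: X_1\to Y$, $T_1x_1=T(x_1,0)$, and $T_2: X_2\to Y$, $T_2x_2=T(0,x_2)$, be its restrictions. If $T_i$ is a strong Daugavet operator on $X_i$ for $i=1,2$, then $T$ is a strong Daugavet operator on $X$. Likewise, if $T_i$ is a rigid strong Daugavet operator on $X_i$ for $i=1,2$, then $T$ is a rigid strong Daugavet operator on $X$.
   Context: All Banach spaces are real; $S(X)$ denotes the unit sphere of $X$. $X_1\oplus_\infty X_2$ is the direct sum with norm $\|(x_1,x_2)\|=\max\{\|x_1\|,\|x_2\|\}$. Let $T$ be a bounded linear operator from a Banach space $X$ to some Banach space $Y$. $T$ is a strong Daugavet operator (on $X$) if for all $x,y\in S(X)$ and every $\varepsilon>0$ there is $z\in S(X)$ with $\|x+z\|\ge 2-\varepsilon$ and $\|T(y-z)\|\le\varepsilon$. $T$ is a rigid strong Daugavet operator (on $X$) if for all $x,y\in S(X)$ there is $z\in S(X)$ with $\|x+z\|=2$ and $T(y-z)=0$. *)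

(* Defs.v *)
From HB Require Import structures.
From mathcomp Require Import all_boot all_order all_algebra.
From mathcomp Require Import boolp classical_sets reals topology normedtype.

Set Implicit Arguments.
Unset Strict Implicit.
Unset Printing Implicit Defensive.

Import Order.TTheory GRing.Theory Num.Theory.
Import numFieldNormedType.Exports.

Local Open Scope classical_set_scope.
Local Open Scope ring_scope.

Section prod_complete.
Context {U V : completeType}.

HB.instance Definition _ := Pointed.on (U * V)%type.

Lemma unif_continuous_fst : unif_continuous (fst : U * V -> U).
Proof.
move=> A entA; exists (A, setT); first by split=> //; exact: entourageT.
by move=> [[a b] [c d]] /= [Aab _]; exists ((a, c), (b, d)).
Qed.

Lemma unif_continuous_snd : unif_continuous (snd : U * V -> V).
Proof.
move=> A entA; exists (setT, A); first by split=> //; exact: entourageT.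
by move=> [[a b] [c d]] /= [_ Acd]; exists ((a, c), (b, d)).
Qed.

Lemma prod_cauchy_cvg (F : set_system (U * V)%type) :
  ProperFilter F -> cauchy F -> cvg F.
Proof.
move=> FF Fc.
have Fc1 : cauchy (fst @ F).
  move=> A entA.
  have [[P Q] /= [FP FQ] PQA] :=
    Fc [set p | A (p.1.1, p.2.1)] (unif_continuous_fst entA).
  exists (fst @` P, fst @` Q).
    by split; [apply: filterS FP|apply: filterS FQ] => p ?; exists p.
  by move=> [_ _] /= [[p Pp <-] [q Qq <-]]; exact: (PQA (p, q)).
have Fc2 : cauchy (snd @ F).
  move=> A entA.
  have [[P Q] /= [FP FQ] PQA] :=
    Fc [set p | A (p.1.2, p.2.2)] (unif_continuous_snd entA).
  exists (snd @` P, snd @` Q).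
    by split; [apply: filterS FP|apply: filterS FQ] => p ?; exists p.
  by move=> [_ _] /= [[p Pp <-] [q Qq <-]]; exact: (PQA (p, q)).
have F1 : cvg (fst @ F) by apply: cauchy_cvg.
have F2 : cvg (snd @ F) by apply: cauchy_cvg.
apply: (cvgP (lim (fst @ F), lim (snd @ F))) => A.
move=> /(cvg_pair F1 F2); rewrite /nbhs /=; by apply: filterS; case.
Qed.

HB.instance Definition _ := Uniform_isComplete.Build (U * V)%type
  prod_cauchy_cvg.

End prod_complete.

HB.instance Definition _ (R : realType) (X1 X2 : completeNormedModType R) :=
  Complete.on (X1 * X2)%type.

(* The norm of [X1 * X2] in the library is the maximum of the norms of the
   components. *)
Definition sum_oo (R : realType) (X1 X2 : completeNormedModType R) :
  completeNormedModType R := (X1 * X2)%type.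

Lemma sum_oo_normE (R : realType) (X1 X2 : completeNormedModType R)
  (x : sum_oo X1 X2) : `|x| = Num.max `|x.1| `|x.2|.
Proof. by []. Qed.

Definition unit_sphere (R : realType) (X : completeNormedModType R) : set X :=
  [set x | `|x| = 1].
Arguments unit_sphere {R} X.

(* By [linear_boundedP] this is the usual notion: [`|T x| <= M * `|x|] for
   some [M] and all [x]. *)
Definition bounded_operator (R : realType) (X Y : completeNormedModType R)
    (T : {linear X -> Y}) : Prop :=
  bounded_near T (nbhs (0 : X)).

Definition strong_Daugavet (R : realType) (X Y : completeNormedModType R)
    (T : {linear X -> Y}) : Prop :=
  bounded_operator T /\
  forall x y, unit_sphere X x -> unit_sphere X y ->
  forall e : R, 0 < e ->
  exists z, [/\ unit_sphere X z, 2 - e <= `|x + z| & `|T (y - z)| <= e].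

Definition rigid_strong_Daugavet (R : realType) (X Y : completeNormedModType R)
    (T : {linear X -> Y}) : Prop :=
  bounded_operator T /\
  forall x y, unit_sphere X x -> unit_sphere X y ->
  exists z, [/\ unit_sphere X z, `|x + z| = 2 & T (y - z) = 0].

Section restrictions.
Context (R : realType) (X1 X2 Y : completeNormedModType R).
Variable T : {linear sum_oo X1 X2 -> Y}.

Definition restr1 (x1 : X1) : Y := T (x1, 0).
Definition restr2 (x2 : X2) : Y := T (0, x2).

Lemma restr1_is_linear : linear restr1.
Proof.
move=> a u v; rewrite /restr1 -linearP; congr (T _).
by apply/pair_equal_spec; split => //=; rewrite scaler0 addr0.
Qed.

Lemma restr2_is_linear : linear restr2.
Proof.
move=> a u v; rewrite /restr2 -linearP; congr (T _).
by apply/pair_equal_spec; split => //=; rewrite scaler0 addr0.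
Qed.

HB.instance Definition _ :=
  GRing.isLinear.Build R X1 Y *:%R restr1 restr1_is_linear.
HB.instance Definition _ :=
  GRing.isLinear.Build R X2 Y *:%R restr2 restr2_is_linear.

End restrictions.

(* Main.v *)
Require Import Defs.
From HB Require Import structures.
From mathcomp Require Import all_boot all_order all_algebra.
From mathcomp Require Import boolp classical_sets reals topology normedtype.
From mathcomp Require Import lra.

(** Let [x] and [y] be unit vectors of the sum. One coordinate of [x], say
    [x.1], has norm 1, and it suffices to change the same coordinate of [y]: for
    [z = (z1, y.2)] the norm of [x + z] is at least that of [x.1 + z1], and
    [T (y - z)] is the image of [y.1 - z1] under the first restriction. The
    difficulty is that [y.1] may have norm less than 1, while the Daugavet
    property speaks of unit vectors only.

    It does extend to [y] in the unit ball ([Daugavet_with_ball]). Write [y] as a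
    convex combination of antipodal unit vectors [w] and [- w]. Replace [w] by a
    unit vector [u] with almost the same image and [x + u] of norm almost 2, and
    then [- w] by a unit vector [v] with almost the same image, such that the
    normalization of [x + u] plus [v] has norm almost 2. Now [x], [u], [v] almost
    lie on one face of the unit ball, so that [x] plus any convex combination
    of [u] and [v] has norm almost 2 ([aligned_triple]). The same combination as
    for [y] is the required vector; it may have norm less than 1, but then
    so does [y.1], hence [y.2] has norm 1 and [z] is still a unit vector.

    The loss of precision is a factor 3, so with precision 0 the argument is
    exact: the strong and the rigid case follow from the same quantitative
    statement ([Daugavet_with_sum]). *)

Set Implicit Arguments.
Unset Strict Implicit.
Unset Printing Implicit Defensive.

Import Order.TTheory GRing.Theory Num.Theory.
Import numFieldNormedType.Exports.

Local Open Scope ring_scope.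

(** The strong Daugavet condition at one fixed precision: strong Daugavet
    operators satisfy it for every [d > 0], rigid ones for [d = 0]. *)
Definition Daugavet_with (R : realType) (X Y : completeNormedModType R)
    (T : {linear X -> Y}) (d : R) : Prop :=
  forall x y, unit_sphere X x -> unit_sphere X y ->
  exists z, [/\ unit_sphere X z, 2 - d <= `|x + z| & `|T (y - z)| <= d].

Section ball.
Context (R : realType).

Lemma norm_convex_le (V : normedModType R) (u v : V) (l c : R) :
  0 <= l <= 1 -> `|u| <= c -> `|v| <= c -> `|l *: u + (1 - l) *: v| <= c.
Proof.
move=> /andP[l0 l1] uc vc; apply: le_trans (ler_normD _ _) _.
by rewrite !normrZ !ger0_norm ?subr_ge0//; nra.
Qed.

(** The Daugavet condition is applied to the normalization of [x + u], whence
    the second hypothesis. Scaling by [s := `|x + u|] turns it into a lower bound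
    [s * (2 - d)] for the norm of [x + u + s *: v]; that vector is
    [x + l *: u + (1 - l) *: v] plus a nonnegative combination of [u] and [v] with
    coefficients of sum [s], so the first part has norm at least
    [s * (1 - d) >= (2 - d) * (1 - d) >= 2 - 3 * d]. *)
Lemma aligned_triple (V : normedModType R) (x u v : V) (d l : R) :
  0 <= d <= 1 -> 0 <= l <= 1 -> `|u| <= 1 -> `|v| <= 1 ->
  2 - d <= `|x + u| -> 2 - d <= `| `|x + u|^-1 *: (x + u) + v| ->
  2 - 3 * d <= `|x + (l *: u + (1 - l) *: v)|.
Proof.
move=> /andP[d0 d1] /andP[l0 l1] u1 v1; set s := `|x + u| => sd sv.
have s0 : 0 < s by lra.
have split_sum : s *: (s^-1 *: (x + u) + v) =
    (x + (l *: u + (1 - l) *: v)) + ((1 - l) *: u + (s - 1 + l) *: v).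
  rewrite scalerDr scalerA mulfV ?gt_eqF// scale1r.
  rewrite -addrA -[RHS]addrA; congr (_ + _).
  rewrite addrACA -!scalerDl (_ : l + (1 - l) = 1) ?scale1r; last lra.
  by congr (_ + _ *: _); lra.
have rest_le : `|(1 - l) *: u + (s - 1 + l) *: v| <= s.
  apply: le_trans (ler_normD _ _) _.
  by rewrite !normrZ !ger0_norm; [nra | lra | lra].
have := ler_normD (x + (l *: u + (1 - l) *: v))
                  ((1 - l) *: u + (s - 1 + l) *: v).
rewrite -split_sum normrZ (gtr0_norm s0); nra.
Qed.

(** The unit vector [x] supplies the direction when [y = 0]. *)
Lemma exists_direction (V : normedModType R) (x y : V) :
  `|x| = 1 -> exists2 w, `|w| = 1 & y = `|y| *: w.
Proof.
move=> x1; have [->|y0] := eqVneq y 0.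
  by exists x; rewrite // normr0 scale0r.
have ny0 : `|y| != 0 by rewrite normr_eq0.
exists (`|y|^-1 *: y); last by rewrite scalerA mulfV// scale1r.
by rewrite normrZ normfV normr_id mulVf.
Qed.

(** The last clause, which keeps unit vectors on the sphere, is what makes
    this usable for a coordinate of a unit vector of a maximum-norm sum. *)
Lemma Daugavet_with_ball (X Y : completeNormedModType R) (T : {linear X -> Y})
    (d : R) (x y : X) :
  0 <= d <= 1 -> Daugavet_with T d -> `|x| = 1 -> `|y| <= 1 ->
  exists z, [/\ `|z| <= 1, 2 - 3 * d <= `|x + z|,
                `|T (y - z)| <= 3 * d & `|y| = 1 -> `|z| = 1].
Proof.
move=> d01 DT x1 yle1; have /andP[d0 d1] := d01.
have [y1|yn1] := eqVneq `|y| 1.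
  have [z [z1 xz Tz]] := DT x y x1 y1.
  rewrite /unit_sphere/= in z1.
  by exists z; split; rewrite ?z1//; lra.
have [w w1 yw] := exists_direction y x1.
have [u [u1 xu Tu]] := DT x w x1 w1.
have nxu0 : `|x + u| != 0 by apply: lt0r_neq0; lra.
have xu1 : `| `|x + u|^-1 *: (x + u) | = 1.
  by rewrite normrZ normfV normr_id mulVf.
have Nw1 : `|- w| = 1 by rewrite normrN.
have [v [v1 xv Tv]] := DT _ _ xu1 Nw1.
rewrite /unit_sphere/= in u1 v1.
pose l := (1 + `|y|) / 2.
have l01 : 0 <= l <= 1.
  by have := normr_ge0 y; rewrite /l => ?; apply/andP; split; lra.
have yl : y = l *: w + (1 - l) *: - w.
  rewrite scalerN -scalerBl {1}yw; congr (_ *: _); rewrite /l; lra.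
move: l l01 yl => l l01 yl.
exists (l *: u + (1 - l) *: v); split.
- by apply: norm_convex_le => //; rewrite ?u1 ?v1.
- by apply: aligned_triple => //; rewrite ?u1 ?v1.
- rewrite [X in T (X - _)]yl opprD addrACA -!scalerBr linearD !linearZ/=.
  by apply: (@le_trans _ _ d); [exact: norm_convex_le | lra].
- by move=> y1; rewrite y1 eqxx in yn1.
Qed.

End ball.

Lemma Daugavet_with_sum (R : realType) (X1 X2 Y : completeNormedModType R)
    (T : {linear sum_oo X1 X2 -> Y}) (d : R) :
  0 <= d <= 1 -> Daugavet_with (restr1 T) d -> Daugavet_with (restr2 T) d ->
  Daugavet_with T (3 * d).
Proof.
move=> d01 D1 D2 [x1 x2] [y1 y2].
rewrite /unit_sphere/= !sum_oo_normE/= => nx ny.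
have y1le : `|y1| <= 1 by rewrite -ny le_max lexx.
have y2le : `|y2| <= 1 by rewrite -ny le_max lexx orbT.
have [x11|x21] : `|x1| = 1 \/ `|x2| = 1.
  by move: nx; rewrite /Num.max; case: ifP => _; [right|left].
- have [z [z1 xz Tz yz]] := Daugavet_with_ball d01 D1 x11 y1le.
  exists (z, y2); split.
  + rewrite sum_oo_normE/=; apply/eqP; rewrite eq_le ge_max z1 y2le/=.
    move: ny; rewrite /Num.max; case: ifP => _ e1.
      by rewrite le_max e1 lexx orbT.
    by rewrite le_max yz// lexx.
  + by rewrite sum_oo_normE le_max xz.
  + suff -> : (y1, y2) - (z, y2) = (y1 - z, 0) :> sum_oo X1 X2 by [].
    by apply/pair_equal_spec; split=> //=; rewrite subrr.
- have [z [z1 xz Tz yz]] := Daugavet_with_ball d01 D2 x21 y2le.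
  exists (y1, z); split.
  + rewrite sum_oo_normE/=; apply/eqP; rewrite eq_le ge_max z1 y1le/=.
    move: ny; rewrite /Num.max; case: ifP => _ e1.
      by rewrite le_max yz// lexx orbT.
    by rewrite le_max e1 lexx.
  + by rewrite sum_oo_normE le_max xz orbT.
  + suff -> : (y1, y2) - (y1, z) = (0, y2 - z) :> sum_oo X1 X2 by [].
    by apply/pair_equal_spec; split=> //=; rewrite subrr.
Qed.

Lemma rigid_Daugavet_with0 (R : realType) (X Y : completeNormedModType R)
    (T : {linear X -> Y}) :
  rigid_strong_Daugavet T <-> bounded_operator T /\ Daugavet_with T 0.
Proof.
split=> -[bT DT]; split=> // x y x1 y1; have [z [z1 xz Tz]] := DT x y x1 y1.
  by exists z; split; rewrite ?xz ?Tz ?subr0 ?normr0.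
exists z; split=> //; last by apply/eqP; rewrite -normr_le0.
apply/eqP; rewrite eq_le; rewrite subr0 in xz; rewrite xz andbT.
by apply: le_trans (ler_normD _ _) _; rewrite x1 z1.
Qed.

Theorem proposition3p1 (R : realType) (X1 X2 Y : completeNormedModType R)
    (T : {linear sum_oo X1 X2 -> Y}) (hT : bounded_operator T) :
  (strong_Daugavet (restr1 T) -> strong_Daugavet (restr2 T) ->
     strong_Daugavet T) /\
  (rigid_strong_Daugavet (restr1 T) -> rigid_strong_Daugavet (restr2 T) ->
     rigid_strong_Daugavet T).
Proof.
split.
- move=> [_ D1] [_ D2]; split=> // x y x1 y1 e e0.
  pose d := Num.min (e / 3) 1.
  have d0 : 0 < d by rewrite lt_min ltr01 andbT; lra.
  have de : d <= e / 3 by rewrite ge_min lexx.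
  have d01 : 0 <= d <= 1 by rewrite ltW//= ge_min lexx orbT.
  have D1d : Daugavet_with (restr1 T) d.
    by move=> a b a1 b1; exact: D1 _ _ a1 b1 _ d0.
  have D2d : Daugavet_with (restr2 T) d.
    by move=> a b a1 b1; exact: D2 _ _ a1 b1 _ d0.
  have [z [z1 xz Tz]] := Daugavet_with_sum d01 D1d D2d x1 y1.
  by exists z; split=> //; lra.
- move=> /rigid_Daugavet_with0[_ D1] /rigid_Daugavet_with0[_ D2].
  apply/rigid_Daugavet_with0; split=> //; rewrite -(mulr0 3).
  by apply: Daugavet_with_sum; rewrite // lexx ler01.
Qed.
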